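(* Assume (A1)–(A4). Run POLD with meta learning rate $\alpha=\sqrt{8/T}$ and step-size set $\mathcal{H}=\{\eta_i=2^{i-1}(7D^2/(2G^2T))^{3/4}: i=1,\dots,N\}$, $N=\lceil\frac34\log_2(1+4T/7)\rceil+1$. Then for every comparator sequence $\mathbf{u}_1,\dots,\mathbf{u}_T\in\mathcal{K}$ with path-length $P_T$, $$\sum_{t=1}^Tf_t(\mathbf{x}_t)-\sum_{t=1}^Tf_t(\mathbf{u}_t)\le\mathcal{O}\big(T^{3/4}(1+P_T)^{1/4}\big),$$ with constants depending only on $D$ and $G$.
   Context: Online convex optimization: for rounds $t=1,\dots,T$ a learner chooses $\mathbf{x}_t\in\mathcal{K}$, then a loss $f_t:\mathcal{K}\to\mathbb{R}$ is revealed (chosen adversarially), the learner suffers $f_t(\mathbf{x}_t)$ and can access $f_t$. Standing assumptions: (A1) $\mathcal{K}\subseteq\mathbb{R}^d$ is convex and compact, contains $\mathbf{0}$, and $\mathcal{K}\subseteq R\mathcal{B}$ where $R\mathcal{B}$ is the closed Euclidean ball of radius $R$ centered at $\mathbf{0}$; set $D=2R$, so $\|\mathbf{x}-\mathbf{x}'\|_2\le D$ for all $\mathbf{x},\mathbf{x}'\in\mathcal{K}$. (A2) Each $f_t$ is $G$-Lipschitz on $\mathcal{K}$, and its (sub)gradients satisfy $\|\nabla f_t(\mathbf{x})\|_2\le G$. (A3) Each $f_t$ is convex on $\mathcal{K}$: $f_t(\mathbf{y})\ge f_t(\mathbf{x})+\nabla f_t(\mathbf{x})^\top(\mathbf{y}-\mathbf{x})$.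 (A4) $0\le f_t(\mathbf{x})\le1$ for all $\mathbf{x}\in\mathcal{K}$ and all $t$. Path-length: $P_T=\sum_{t=2}^T\|\mathbf{u}_{t-1}-\mathbf{u}_t\|_2$. Infeasible projection oracle $\mathcal{O}_{\mathrm{IP}}(\mathcal{K},\epsilon,\mathbf{x}_0,\mathbf{y}_0)$: given $\epsilon>0$, $\mathbf{x}_0\in\mathcal{K}$, $\mathbf{y}_0\in\mathbb{R}^d$, returns $(\mathbf{x},\tilde{\mathbf{y}})\in\mathcal{K}\times R\mathcal{B}$ with $\|\mathbf{x}-\tilde{\mathbf{y}}\|_2\le\sqrt{3\epsilon}$ and $\|\tilde{\mathbf{y}}-\mathbf{z}\|_2\le\|\mathbf{y}_0-\mathbf{z}\|_2$ for all $\mathbf{z}\in\mathcal{K}$. Algorithm $\mathrm{BOGD}_{\mathrm{IP}}$ (step size $\eta$, block size $K$, tolerance $\epsilon$): pick $\mathbf{x}_1\in\mathcal{K}$ arbitrary, $\tilde{\mathbf{y}}_1=\mathbf{x}_1$. Rounds are split into blocks; block $m$ consists of rounds $(m-1)K+1,\dots,mK$. At every round $t$ of block $m$ the algorithm plays $\mathbf{x}_t=\mathbf{x}_m$. At the last round of block $m$ it sets $\mathbf{y}_{m+1}=\tilde{\mathbf{y}}_m-\eta\sum_{r=(m-1)K+1}^{mK}\nabla f_r(\mathbf{x}_m)$ and $(\mathbf{x}_{m+1},\tilde{\mathbf{y}}_{m+1})=\mathcal{O}_{\mathrm{IP}}(\mathcal{K},\epsilon,\mathbf{x}_m,\mathbf{y}_{m+1})$.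 Unless stated otherwise, it is run with $K=\eta^{-2/3}$ and $\epsilon=\eta^{2/3}$ (block sizes assumed integral). Algorithm POLD (meta learning rate $\alpha$, finite step-size set $\mathcal{H}=\{\eta_1,\dots,\eta_N\}$): for each $i$, run an expert $E_i$, an instance of $\mathrm{BOGD}_{\mathrm{IP}}$ with step size $\eta_i$ (block size $\eta_i^{-2/3}$, tolerance $\eta_i^{2/3}$), and set initial weight $w_1^i=\frac{C}{i(i+1)}$ with $C=1+\frac1N$. At round $t$, receive $\mathbf{x}_t^i$ from each $E_i$, play $\mathbf{x}_t=\sum_i w_t^i\mathbf{x}_t^i$, update $w_{t+1}^i=\frac{w_t^ie^{-\alpha f_t(\mathbf{x}_t^i)}}{\sum_{\mu}w_t^\mu e^{-\alpha f_t(\mathbf{x}_t^\mu)}}$, and pass $f_t$ to every expert.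
   Formalization: Block sizes η_i^{-2/3} are rounded up to the next integer, since they cannot all be integers at once (N ≥ 2 and consecutive ratios are 2^{2/3}, irrational); R > 0 and G > 0 are assumed so that the step sizes are positive and well defined. *)

(* Defs.v *)
From HB Require Import structures.
From mathcomp Require Import all_boot all_order all_algebra.
From mathcomp Require Import all_classical all_reals all_analysis.
Set Implicit Arguments. Unset Strict Implicit. Unset Printing Implicit Defensive.
Import Order.TTheory GRing.Theory Num.Theory.
Import numFieldNormedType.Exports.
Local Open Scope classical_set_scope.
Local Open Scope ring_scope.

Section OCO.
Variables (R : realType) (d : nat).
Local Notation vec := 'rV[R]_d.

Definition dotp (u v : vec) : R := \sum_(j < d) u 0 j * v 0 j.
Definition enorm (u : vec) : R := Num.sqrt (dotp u u).

Definition convex_set (K : set vec) : Prop :=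
  forall x y, K x -> K y -> forall l : R, 0 <= l <= 1 -> K (l *: x + (1 - l) *: y).

Definition A1 (K : set vec) (Rad : R) : Prop :=
  [/\ convex_set K, compact K, K 0 & forall x, K x -> enorm x <= Rad].

(* (A2)-(A4) for a single loss f with chosen (sub)gradient map g *)
Definition loss_ok (K : set vec) (G : R) (f : vec -> R) (g : vec -> vec) : Prop :=
  [/\ (forall x y, K x -> K y -> `|f x - f y| <= G * enorm (x - y)),
      (forall x, K x -> enorm (g x) <= G),
      (forall x y, K x -> K y -> f y >= f x + dotp (g x) (y - x))
    & (forall x, K x -> 0 <= f x <= 1)].

(* Infeasible projection oracle specification: O eps x0 y0 = (x, ytilde) *)
Definition IP_oracle (K : set vec) (Rad : R) (O : R -> vec -> vec -> vec * vec) : Prop :=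
  forall eps x0 y0, 0 < eps -> K x0 ->
    [/\ K (O eps x0 y0).1,
        enorm (O eps x0 y0).2 <= Rad,
        enorm ((O eps x0 y0).1 - (O eps x0 y0).2) <= Num.sqrt (3 * eps)
      & forall z, K z -> enorm ((O eps x0 y0).2 - z) <= enorm (y0 - z)].

(* BOGD_IP with step eta, block size Kb, tolerance eps, oracle O, initial point x1,
   gradient oracle g (g r x = grad f_r (x)).  Blocks are numbered from 0 here:
   block m (0-indexed) covers rounds m*Kb+1 .. (m+1)*Kb. bogd_state m = (x_{m+1}, ytilde_{m+1}). *)
Fixpoint bogd_state (O : R -> vec -> vec -> vec * vec) (eta : R) (Kb : nat) (eps : R)
    (x1 : vec) (g : nat -> vec -> vec) (m : nat) : vec * vec :=
  match m with
  | 0%N => (x1, x1)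
  | m'.+1 =>
      let st := bogd_state O eta Kb eps x1 g m' in
      O eps st.1 (st.2 - eta *: \sum_(m' * Kb + 1 <= r < m'.+1 * Kb + 1) g r st.1)
  end.

Definition bogd_play O eta Kb eps x1 g (t : nat) : vec :=
  (bogd_state O eta Kb eps x1 g ((t - 1) %/ Kb)).1.

(* block size eta^{-2/3} rounded up to an integer (paper assumes it integral) *)
Definition blocksize (eta : R) : nat := `|Num.ceil (eta `^ (- (2 / 3)))|%N.

Definition expert_play O (eta : R) x1 g (t : nat) : vec :=
  bogd_play O eta (blocksize eta) (eta `^ (2 / 3)) x1 g t.

Definition pold_N (T : nat) : nat :=
  (`|Num.ceil ((3 / 4 : R) * (ln (1 + 4 * T%:R / 7 : R) / ln (2 : R)))|%N).+1.

Definition pold_eta (Rad G : R) (T i : nat) : R :=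
  2 ^+ (i - 1) * ((7 * (2 * Rad) ^+ 2) / (2 * G ^+ 2 * T%:R)) `^ (3 / 4).

Definition pold_alpha (T : nat) : R := Num.sqrt (8 / T%:R : R).

(* POLD: xs i t = play of expert i (1 <= i <= N) at round t; f t = loss at round t.
   pold_w n i = weight w_{n+1}^i. *)
Fixpoint pold_w (N : nat) (alpha : R) (f : nat -> vec -> R) (xs : nat -> nat -> vec)
    (n : nat) : nat -> R :=
  match n with
  | 0%N => fun i => (1 + N%:R^-1) / (i%:R * (i%:R + 1))
  | n'.+1 =>
      let w := pold_w N alpha f xs n' in
      fun i => w i * expR (- alpha * f n'.+1 (xs i n'.+1)) /
               \sum_(1 <= mu < N.+1) w mu * expR (- alpha * f n'.+1 (xs mu n'.+1))
  end.

Definition pold_play N alpha f xs (t : nat) : vec :=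
  \sum_(1 <= i < N.+1) pold_w N alpha f xs (t - 1) i *: xs i t.

Definition path_length (u : nat -> vec) (T : nat) : R :=
  \sum_(2 <= t < T.+1) enorm (u (t - 1)%N - u t).

End OCO.

(* Main.v *)
Require Import Defs.
From HB Require Import structures.
From mathcomp Require Import all_boot all_order all_algebra.
From mathcomp Require Import all_classical all_reals all_analysis.
From mathcomp Require Import ring lra zify.
Set Implicit Arguments.
Unset Strict Implicit.
Unset Printing Implicit Defensive.
Import Order.TTheory GRing.Theory Num.Theory.
Import numFieldNormedType.Exports.
Local Open Scope classical_set_scope.
Local Open Scope ring_scope.

(** Each expert is blocked gradient descent: comparing block [m] with the
    comparator at its first round gives the usual telescoping inequality, where
    infeasibility costs [sqrt (3 eps)] per round and the moving comparator costs
    a multiple of the path length [P] divided by [eta].  With [h = eta^(1/3)],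
    the expert regret is of order [T h + (1 + P) / h ^ 3], minimised at
    [h ~ ((1 + P) / T)^(1/4)]; the geometric grid contains such a step size up to
    a factor 2, and its index [k] satisfies [2^(k/3) = O((1 + P)^(1/4))].  Hedge
    therefore loses only [sqrt T * ln k = O(T^(1/2) (1 + P)^(1/4))] against that
    expert.  As only the order matters, Hoeffding's lemma is replaced by
    [exp (- x) <= 1 - x + x ^ 2] for [x >= 0]. *)

(** * Inner product and Euclidean norm on row vectors *)

Section EuclideanNorm.
Variables (R : realType) (d : nat).
Implicit Types (u v w : 'rV[R]_d) (a : R).

Lemma dotpC u v : dotp u v = dotp v u.
Proof. by apply: eq_bigr => j _; rewrite mulrC. Qed.

Lemma dotpDl u v w : dotp (u + v) w = dotp u w + dotp v w.
Proof. by rewrite -big_split; apply: eq_bigr => j _; rewrite mxE mulrDl. Qed.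

Lemma dotpZl a u w : dotp (a *: u) w = a * dotp u w.
Proof. by rewrite mulr_sumr; apply: eq_bigr => j _; rewrite mxE mulrA. Qed.

Lemma dotp0l w : dotp 0 w = 0.
Proof. by rewrite -(scale0r (0 : 'rV[R]_d)) dotpZl mul0r. Qed.

Lemma dotpNl u w : dotp (- u) w = - dotp u w.
Proof. by rewrite -scaleN1r dotpZl mulN1r. Qed.

Lemma dotpDr u v w : dotp w (u + v) = dotp w u + dotp w v.
Proof. by rewrite !(dotpC w) dotpDl. Qed.

Lemma dotpZr a u w : dotp w (a *: u) = a * dotp w u.
Proof. by rewrite !(dotpC w) dotpZl. Qed.

Lemma dotpNr u w : dotp w (- u) = - dotp w u.
Proof. by rewrite !(dotpC w) dotpNl. Qed.

Lemma dotp_suml (I : Type) (s : seq I) (F : I -> 'rV[R]_d) w :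
  dotp (\sum_(i <- s) F i) w = \sum_(i <- s) dotp (F i) w.
Proof.
by elim/big_rec2: _ => [|i y x _ <-]; rewrite ?dotp0l ?dotpDl.
Qed.

Lemma dotp_sumr (I : Type) (s : seq I) (F : I -> 'rV[R]_d) w :
  dotp w (\sum_(i <- s) F i) = \sum_(i <- s) dotp w (F i).
Proof. by rewrite dotpC dotp_suml; apply: eq_bigr => i _; rewrite dotpC. Qed.

Lemma dotp_ge0 u : 0 <= dotp u u.
Proof. by apply: sumr_ge0 => j _; rewrite -expr2 sqr_ge0. Qed.

Lemma enorm_ge0 u : 0 <= enorm u.
Proof. exact: sqrtr_ge0. Qed.

Lemma sqr_enorm u : enorm u ^+ 2 = dotp u u.
Proof. exact/sqr_sqrtr/dotp_ge0. Qed.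

Lemma enorm0 : enorm (0 : 'rV[R]_d) = 0.
Proof. by rewrite /enorm dotp0l sqrtr0. Qed.

Lemma enormN u : enorm (- u) = enorm u.
Proof. by rewrite /enorm dotpNl dotpNr opprK. Qed.

Lemma dotp_eq0 u : dotp u u = 0 -> u = 0.
Proof.
move=> /eqP; rewrite psumr_eq0 => [/allP h|j _]; last by rewrite -expr2 sqr_ge0.
apply/rowP => j; rewrite mxE; apply/eqP.
by have := h j (mem_index_enum j); rewrite /= -expr2 sqrf_eq0.
Qed.

(** For nonzero [v], the squared norm of [dotp v v *: u - dotp u v *: v] factors as [dotp v v] times
    the Cauchy-Schwarz defect, which is therefore nonnegative. *)
Lemma dotp_le_enorm u v : dotp u v <= enorm u * enorm v.
Proof.
apply: le_trans (ler_norm _) _.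
rewrite -(ler_pXn2r (n := 2)) ?nnegrE ?mulr_ge0 ?enorm_ge0 //.
rewrite exprMn !sqr_enorm real_normK ?num_real //.
have [/dotp_eq0 ->|v0] := eqVneq (dotp v v) 0.
  by rewrite (dotpC u) !dotp0l expr0n mulr0.
have vp : 0 < dotp v v by rewrite lt0r v0 dotp_ge0.
have := dotp_ge0 (dotp v v *: u - dotp u v *: v).
rewrite !(dotpDl, dotpDr, dotpNl, dotpNr, dotpZl, dotpZr) (dotpC v u).
rewrite (_ : _ + _ = dotp v v * (dotp u u * dotp v v - dotp u v ^+ 2)); last by ring.
by rewrite pmulr_rge0 // subr_ge0.
Qed.

Lemma enormD u v : enorm (u + v) <= enorm u + enorm v.
Proof.
rewrite -(ler_pXn2r (n := 2)) ?nnegrE ?addr_ge0 ?enorm_ge0 //.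
rewrite sqrrD !sqr_enorm dotpDl !dotpDr (dotpC v u).
by have := dotp_le_enorm u v; lra.
Qed.

Lemma enorm_sum (I : eqType) (s : seq I) (F : I -> 'rV[R]_d) :
  enorm (\sum_(i <- s) F i) <= \sum_(i <- s) enorm (F i).
Proof.
elim/big_rec2: _ => [|i y x _ le]; first by rewrite enorm0.
by apply: le_trans (enormD _ _) _; rewrite lerD2l.
Qed.

End EuclideanNorm.

(** * Path length of the comparator sequence *)

Section PathLength.
Variables (R : realType) (d : nat) (u : nat -> 'rV[R]_d).

Lemma path_lengthS n : (0 < n)%N ->
  path_length u n.+1 = path_length u n + enorm (u n - u n.+1).
Proof. by move=> n0; rewrite /path_length big_nat_recr //= subn1. Qed.

Lemma path_length_ge0 n : 0 <= path_length u n.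
Proof. by apply: sumr_ge0 => i _; exact: enorm_ge0. Qed.

Lemma enorm_le_path_length m n : (0 < m)%N -> (m <= n)%N ->
  enorm (u m - u n) <= path_length u n - path_length u m.
Proof.
move=> m0; elim: n => [|n IH]; first by lia.
rewrite leq_eqVlt => /predU1P[<-|mn]; first by rewrite !subrr enorm0.
rewrite path_lengthS; last by lia.
have -> : u m - u n.+1 = (u m - u n) + (u n - u n.+1) by rewrite addrA subrK.
by apply: le_trans (enormD _ _) _; have := IH mn; lra.
Qed.

Lemma path_length_mono m n : (0 < m)%N -> (m <= n)%N ->
  path_length u m <= path_length u n.
Proof.
move=> m0 mn; rewrite -subr_ge0.
exact: le_trans (enorm_ge0 _) (enorm_le_path_length m0 mn).
Qed.

(** Used to get [1 + P <= (1 + D) T], which trades powers of [1 + P] for powers of [T], and to keep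
    the target step size inside the grid. *)
Lemma path_length_le D n : 0 <= D -> (forall s t, enorm (u s - u t) <= D) ->
  path_length u n <= n%:R * D.
Proof.
move=> D0 uD; case: n => [|n]; first by rewrite mul0r /path_length big_geq.
elim: n => [|n IH]; first by rewrite /path_length big_geq // mul1r.
rewrite path_lengthS // -[n.+2%:R]natr1 mulrDl mul1r; exact: lerD.
Qed.

End PathLength.

(** * Regret of a single blocked gradient descent expert *)

Section Expert.
Variables (R : realType) (d : nat) (K : set 'rV[R]_d) (Rad G : R).
Variables (f : nat -> 'rV[R]_d -> R) (g : nat -> 'rV[R]_d -> 'rV[R]_d).
Variables (O : R -> 'rV[R]_d -> 'rV[R]_d -> 'rV[R]_d * 'rV[R]_d).
Variables (x1 : 'rV[R]_d) (u : nat -> 'rV[R]_d).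
Variables (eta eps : R) (Kb : nat).
Hypotheses (KRad : forall x, K x -> enorm x <= Rad).
Hypotheses (fP : forall t, loss_ok K G (f t) (g t)) (OP : IP_oracle K Rad O).
Hypotheses (x1K : K x1) (uK : forall t, K (u t)).
Hypotheses (eta0 : 0 < eta) (eps0 : 0 < eps) (Kb0 : (0 < Kb)%N) (G0 : 0 < G).

Local Notation state := (bogd_state O eta Kb eps x1 g).
Local Notation play := (bogd_play O eta Kb eps x1 g).

(** Membership in [K] is carried along because the oracle is specified only at base points of [K].
    Initially both points equal [x1], so the gap is zero. *)
Lemma bogd_stateP m : [/\ K (state m).1, enorm (state m).2 <= Rad
  & enorm ((state m).1 - (state m).2) <= Num.sqrt (3 * eps)].
Proof.
elim: m => [|m [xK _ _]]; first by split; rewrite ?subrr ?enorm0 ?sqrtr_ge0 ?KRad.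
by have [? ? ? _] := @OP eps (state m).1
  ((state m).2 - eta *: \sum_(m * Kb + 1 <= r < m.+1 * Kb + 1) g r (state m).1)
  eps0 xK.
Qed.

Lemma bogd_play_block m t : (m * Kb + 1 <= t < m.+1 * Kb + 1)%N ->
  play t = (state m).1.
Proof.
move=> tm; rewrite /bogd_play; congr ((state _).1).
by apply/eqP; rewrite eqn_leq leq_divRL // -ltnS ltn_divLR //; apply/andP; split; lia.
Qed.

Lemma bogd_playK t : K (play t).
Proof. by rewrite /bogd_play; have [] := bogd_stateP ((t - 1) %/ Kb). Qed.

(* The usual gradient descent inequality for y_{m+1}, paying the feasibility
   gap |x_m - y_m| once per round. *)
Lemma bogd_step m z : K z ->
  \sum_(m * Kb + 1 <= r < m.+1 * Kb + 1) dotp (g r (state m).1) ((state m).1 - z)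
  <= Kb%:R * G * Num.sqrt (3 * eps) + eta * (Kb%:R * G) ^+ 2 / 2
     + (enorm ((state m).2 - z) ^+ 2 - enorm ((state m.+1).2 - z) ^+ 2) / (2 * eta).
Proof.
move=> zK; have [xK yR xy] := bogd_stateP m.
set x := (state m).1; set y := (state m).2; rewrite -dotp_suml.
set S := \sum_(_ <= r < _) _.
have [_ _ _ /(_ z zK)] := @OP eps x (y - eta *: S) eps0 xK.
have -> : O eps x (y - eta *: S) = state m.+1 by [].
set y' := (state m.+1).2 => y'z.
have SG : enorm S <= Kb%:R * G.
  apply: le_trans (enorm_sum _ _) _.
  apply: (@le_trans _ _ (\sum_(m * Kb + 1 <= r < m.+1 * Kb + 1) G)).
    by apply: ler_sum => r _; have [_ + _ _] := fP r; apply.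
  rewrite sumr_const_nat.
  have -> : (m.+1 * Kb + 1 - (m * Kb + 1))%N = Kb by rewrite mulSn; lia.
  by rewrite mulr_natl.
have SS : dotp S S <= (Kb%:R * G) ^+ 2.
  by rewrite -sqr_enorm ler_pXn2r ?nnegrE ?enorm_ge0 // (le_trans (enorm_ge0 S)).
have Sxy : dotp S (x - y) <= Kb%:R * G * Num.sqrt (3 * eps).
  by apply: le_trans (dotp_le_enorm _ _) _; rewrite ler_pM ?enorm_ge0.
(* The oracle does not increase the distance to [z], so the square of the unprojected gradient step
   may be expanded instead. *)
have y'z2 : enorm (y' - z) ^+ 2
    <= enorm (y - z) ^+ 2 - 2 * eta * dotp S (y - z) + eta ^+ 2 * dotp S S.
  apply: (@le_trans _ _ (enorm (y - eta *: S - z) ^+ 2)).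
    by rewrite ler_pXn2r ?nnegrE ?enorm_ge0.
  have -> : y - eta *: S - z = (y - z) - eta *: S by rewrite addrAC.
  rewrite !sqr_enorm; move: (y - z) => w.
  rewrite !(dotpDl, dotpDr, dotpNl, dotpNr, dotpZl, dotpZr) (dotpC w S).
  by rewrite le_eqVlt; apply/orP; left; apply/eqP; ring.
have -> : x - z = (x - y) + (y - z) by rewrite addrA subrK.
rewrite dotpDr -addrA; apply: lerD => //.
have e2 : 0 < 2 * eta by rewrite mulr_gt0.
rewrite -(ler_pM2l e2) mulrDr [X in _ <= _ + X]mulrC divfK ?gt_eqF //.
have : eta ^+ 2 * dotp S S <= eta ^+ 2 * (Kb%:R * G) ^+ 2.
  by rewrite ler_pM2l // exprn_gt0.
have -> : 2 * eta * (eta * (Kb%:R * G) ^+ 2 / 2) = eta ^+ 2 * (Kb%:R * G) ^+ 2.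
  by field.
by lra.
Qed.

Local Notation D := (2 * Rad).

Let enormB_le (x y : 'rV[R]_d) : enorm x <= Rad -> enorm y <= Rad -> enorm (x - y) <= D.
Proof.
by move=> xR yR; apply: le_trans (enormD _ _) _; rewrite enormN; lra.
Qed.

(** Induction on the number of blocks. The negative squared distance is kept so that the sum
    telescopes; it refers to the comparator at the first round of the next block, where the path
    length is read too. *)
Lemma bogd_blocks M :
  \sum_(1 <= t < M * Kb + 1) (f t (play t) - f t (u t))
  <= M%:R * (Kb%:R * G * Num.sqrt (3 * eps) + eta * (Kb%:R * G) ^+ 2 / 2)
     + (D ^+ 2 - enorm ((state M).2 - u (M * Kb + 1)%N) ^+ 2
        + 2 * D * path_length u (M * Kb + 1)) / (2 * eta)
     + Kb%:R * G * path_length u (M * Kb + 1).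
Proof.
have e2 : 0 < (2 * eta)^-1 by rewrite invr_gt0 mulr_gt0.
elim: M => [|m IH].
  rewrite mul0n add0n big_geq // mul0r add0r /path_length big_geq // !mulr0 !addr0.
  rewrite pmulr_lge0 // subr_ge0 ler_pXn2r ?nnegrE ?enorm_ge0 //; last first.
    by rewrite mulr_ge0 // (le_trans (enorm_ge0 x1)) // KRad.
  by apply: enormB_le; rewrite KRad.
set a := (m * Kb + 1)%N in IH *; set b := (m.+1 * Kb + 1)%N.
have a0 : (0 < a)%N by rewrite /a; lia.
have ab : (a <= b)%N by rewrite /a /b mulSn; lia.
rewrite (@big_cat_nat _ _ _ a) //=.
set P := path_length u in IH *.
have uab t : (a <= t < b)%N -> enorm (u a - u t) <= P b - P a.
  move=> /andP[at_ tb]; apply: le_trans (@enorm_le_path_length _ _ u _ _ a0 at_) _.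
  by rewrite lerD2r; apply: path_length_mono; lia.
have [xK yR xy] := bogd_stateP m; have [xK' yR' xy'] := bogd_stateP m.+1.
(* The comparator is frozen at the first round [a] of the block: convexity linearises the loss, and
   replacing [u t] by [u a] costs at most [G] times the path travelled in the block. *)
have block : \sum_(a <= t < b) (f t (play t) - f t (u t))
   <= \sum_(a <= t < b) dotp (g t (state m).1) ((state m).1 - u a)
      + Kb%:R * G * (P b - P a).
  have -> : Kb%:R * G * (P b - P a) = \sum_(a <= t < b) G * (P b - P a).
    rewrite sumr_const_nat.
    have -> : (b - a)%N = Kb by rewrite /a /b mulSn; lia.
    by rewrite -mulrA mulr_natl.
  rewrite -big_split /= big_nat_cond [leRHS]big_nat_cond.
  apply: ler_sum => t /andP[tab _]; rewrite (@bogd_play_block m) //.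
  have [_ gG /(_ _ _ xK (uK t)) fc _] := fP t.
  have -> : (state m).1 - u a = - (u t - (state m).1) - (u a - u t).
    by apply/rowP => j; rewrite !mxE; lra.
  rewrite dotpDr dotpNr dotpNr.
  have : dotp (g t (state m).1) (u a - u t) <= G * (P b - P a).
    apply: le_trans (dotp_le_enorm _ _) _.
    by rewrite ler_pM ?enorm_ge0 ?gG // uab.
  by lra.
have := bogd_step m (uK a); set A := \sum_(a <= t < b) _ in block * => step.
set y' := (state m.+1).2 in yR' step *.
(* Moving the reference point from [u a] to [u b]: the difference of squares is a difference, at
   most the path travelled, times a sum, at most [2 * D]. *)
have drift : enorm (y' - u b) ^+ 2 <= enorm (y' - u a) ^+ 2 + 2 * D * (P b - P a).
  have Pab : enorm (u a - u b) <= P b - P a by exact: enorm_le_path_length.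
  have := enormD (y' - u a) (u a - u b); rewrite addrA subrK => tri.
  have n1 : enorm (y' - u a) <= D by apply: enormB_le => //; exact: KRad.
  have n2 : enorm (y' - u b) <= D by apply: enormB_le => //; exact: KRad.
  have := enorm_ge0 (y' - u a); have := enorm_ge0 (y' - u b).
  have := enorm_ge0 (u a - u b).
  move: (enorm _) (enorm (y' - u a)) (enorm (y' - u b)) Pab tri n1 n2 => p q r.
  move=> pP rqp qD rD p0 r0 q0.
  have : (r - q) * (r + q) <= p * (r + q) by rewrite ler_wpM2r ?addr_ge0; lra.
  have : p * (r + q) <= p * (2 * D) by rewrite ler_wpM2l; lra.
  have : p * (2 * D) <= (P b - P a) * (2 * D) by rewrite ler_wpM2r; lra.
  by lra.
rewrite -natr1 mulrDl mul1r.
have : (enorm (y' - u b) ^+ 2 - enorm (y' - u a) ^+ 2 - 2 * D * (P b - P a)) / (2 * eta) <= 0.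
  by rewrite pmulr_lle0 //; lra.
by move: IH block step; lra.
Qed.

(** Complete blocks are covered by [bogd_blocks]; the incomplete last one has fewer than [Kb]
    rounds, each of regret at most 1 because losses lie in [[0, 1]]. *)
Lemma bogd_regret T :
  \sum_(1 <= t < T.+1) (f t (play t) - f t (u t))
  <= T%:R * (G * Num.sqrt (3 * eps) + eta * Kb%:R * G ^+ 2 / 2)
     + (D ^+ 2 + 2 * D * (path_length u T + D)) / (2 * eta)
     + Kb%:R * (G * (path_length u T + D) + 1).
Proof.
have D0 : 0 <= D by rewrite mulr_ge0 // (le_trans (enorm_ge0 x1)) // KRad.
set M := (T %/ Kb)%N.
have MT : (M * Kb <= T)%N by exact: leq_trunc_div.
have TM : (T < M * Kb + Kb)%N by rewrite /M {1}(divn_eq T Kb) ltn_add2l ltn_pmod.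
rewrite (@big_cat_nat _ _ _ (M * Kb + 1)) //=; [|lia..].
have rest : \sum_(M * Kb + 1 <= t < T.+1) (f t (play t) - f t (u t)) <= Kb%:R.
  apply: (@le_trans _ _ (\sum_(M * Kb + 1 <= t < T.+1) 1)).
    apply: ler_sum => t _; have [_ _ _ f01] := fP t.
    by have := f01 _ (bogd_playK t); have := f01 _ (uK t); lra.
  by rewrite sumr_const_nat ler_nat; lia.
have := bogd_blocks M.
(* Round [M * Kb + 1] can be [T + 1], one past the horizon; the extra [D] pays for that step. *)
have : path_length u (M * Kb + 1) <= path_length u T + D.
  apply: (@le_trans _ _ (path_length u T.+1)).
    by apply: path_length_mono; lia.
  case: T {MT TM rest} @M => [|T] /=.
    by rewrite /path_length !big_geq // add0r.
  by rewrite path_lengthS // lerD2l; apply: enormB_le; apply: KRad.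
move: (path_length _ (_ + _)) => P PT.
set V := enorm _ ^+ 2.
have V0 : 0 <= V by rewrite sqr_ge0.
have : (D ^+ 2 - V + 2 * D * P) / (2 * eta)
    <= (D ^+ 2 + 2 * D * (path_length u T + D)) / (2 * eta).
  rewrite ler_wpM2r ?invr_ge0 ?mulr_ge0 ?(ltW eta0) //.
  have := ler_wpM2l (mulr_ge0 (ler0n _ 2) D0) PT; lra.
have : Kb%:R * G * P <= Kb%:R * G * (path_length u T + D).
  by rewrite ler_wpM2l // mulr_ge0 // ltW.
have : M%:R * (Kb%:R * G * Num.sqrt (3 * eps) + eta * (Kb%:R * G) ^+ 2 / 2)
    <= T%:R * (G * Num.sqrt (3 * eps) + eta * Kb%:R * G ^+ 2 / 2).
  rewrite (_ : _ * _ = (M * Kb)%:R *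
      (G * Num.sqrt (3 * eps) + eta * Kb%:R * G ^+ 2 / 2)); last first.
    by rewrite natrM; field.
  rewrite ler_wpM2r ?ler_nat // addr_ge0 ?mulr_ge0 ?sqrtr_ge0 ?invr_ge0 ?exprn_ge0 //; exact: ltW.
by lra.
Qed.

End Expert.

(** Normalising by the total weight [W] lets the induction add one point at a time, as a two-point
    combination with coefficient [W / (W + w n.+2)]. *)
Lemma convex_set_sum (R : realType) (d : nat) (K : set 'rV[R]_d)
    (n : nat) (w : nat -> R) (x : nat -> 'rV[R]_d) :
  Defs.convex_set K -> (forall i, (0 < i)%N -> 0 < w i) -> (forall i, K (x i)) ->
  (0 < n)%N ->
  K ((\sum_(1 <= i < n.+1) w i)^-1 *: \sum_(1 <= i < n.+1) w i *: x i).
Proof.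
move=> cK w0 xK; case: n => // n _; elim: n => [|n IH].
  by rewrite !big_nat1 scalerA mulVf ?scale1r // gt_eqF // w0.
set W := \sum_(1 <= i < n.+2) w i in IH *.
set X := \sum_(1 <= i < n.+2) _ in IH *.
rewrite !(big_nat_recr n.+2) //= -/W -/X.
have W0 : 0 < W.
  rewrite /W big_nat_recr //= ltr_wpDl ?w0 // big_nat_cond sumr_ge0 // => i.
  by case/andP=> /andP[i0 _] _; exact/ltW/w0.
have wn : 0 < w n.+2 by exact: w0.
have := cK _ _ IH (xK n.+2) (W / (W + w n.+2)).
rewrite scalerA.
have -> : W / (W + w n.+2) * W^-1 = (W + w n.+2)^-1.
  by field; rewrite !gt_eqF // addr_gt0.
have -> : 1 - W / (W + w n.+2) = (W + w n.+2)^-1 * w n.+2.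
  by field; rewrite gt_eqF // addr_gt0.
rewrite -scalerA -scalerDr; apply; rewrite divr_ge0 ?addr_ge0 ?(ltW W0) ?(ltW wn) //=.
by rewrite ler_pdivrMr ?addr_gt0 // mul1r lerDl ltW.
Qed.

(** Both sides are compared with [1 / (1 + x)], using [(1 + x) (1 - x + x^2) = 1 + x^3 >= 1]. *)
Lemma expRN_le_quad (R : realType) (x : R) : 0 <= x -> expR (- x) <= 1 - x + x ^+ 2.
Proof.
move=> x0; rewrite expRN; have x1 : 0 < 1 + x by lra.
apply: (@le_trans _ _ (1 + x)^-1).
  by rewrite lef_pV2 ?posrE ?expR_gt0 // expR_ge1Dx.
rewrite -(ler_pM2l x1) mulfV ?gt_eqF //.
have -> : (1 + x) * (1 - x + x ^+ 2) = 1 + x ^+ 3 by ring.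
by rewrite lerDl exprn_ge0.
Qed.

(** * Exponential weights over the experts *)

Section Hedge.
Variables (R : realType) (d : nat) (N : nat) (alpha : R).
Variables (f : nat -> 'rV[R]_d -> R) (xs : nat -> nat -> 'rV[R]_d).
Hypotheses (N0 : (0 < N)%N) (alpha0 : 0 < alpha).

Local Notation w := (pold_w N alpha f xs).

(** Experts are numbered from 1; at [i = 0] the initial weight has denominator zero and so is
    zero. *)
Lemma pold_w_gt0 n i : (0 < i)%N -> 0 < w n i.
Proof.
elim: n i => [|n IH] i i0 /=.
  by rewrite divr_gt0 ?mulr_gt0 ?addr_gt0 ?invr_gt0 ?ltr0n.
rewrite divr_gt0 ?mulr_gt0 ?IH ?expR_gt0 //.
rewrite big_nat_recl // ltr_wpDr ?mulr_gt0 ?expR_gt0 ?IH //.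
by apply: sumr_ge0 => j _; rewrite mulr_ge0 ?expR_ge0 // ltW // IH.
Qed.

Lemma pold_Z_gt0 n (F : nat -> R) :
  0 < \sum_(1 <= i < N.+1) w n i * expR (F i).
Proof.
rewrite big_nat_recl // ltr_wpDr ?mulr_gt0 ?expR_gt0 ?pold_w_gt0 //.
by apply: sumr_ge0 => j _; rewrite mulr_ge0 ?expR_ge0 // ltW // pold_w_gt0.
Qed.

(** Initially [1 / (i (i + 1)) = 1 / i - 1 / (i + 1)] telescopes to [N / (N + 1)], which the factor
    [1 + 1 / N] corrects exactly; later weights are normalised by construction. *)
Lemma pold_w_sum1 n : \sum_(1 <= i < N.+1) w n i = 1.
Proof.
case: n => [|n] /=; last by rewrite -mulr_suml mulfV // gt_eqF // pold_Z_gt0.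
have tele : \sum_(1 <= i < N.+1) (- (i.+1%:R : R)^-1 - - i%:R^-1) = 1 - N.+1%:R^-1.
  by rewrite (telescope_sumr (fun i => - (i%:R : R)^-1)) // opprK invr1 addrC.
rewrite -mulr_sumr (_ : \sum_(_ <= _ < _) _ = 1 - N.+1%:R^-1).
  rewrite -natr1; field.
  by rewrite natr1 !pnatr_eq0 /= -lt0n N0.
rewrite -tele big_nat_cond [RHS]big_nat_cond; apply: eq_bigr => i.
case/andP=> /andP[i0 _] _; rewrite -natr1; field.
by rewrite natr1 !pnatr_eq0 /= -lt0n i0.
Qed.

Lemma pold_w_le1 n i : (0 < i <= N)%N -> w n i <= 1.
Proof.
move=> /andP[i0 iN]; rewrite -(pold_w_sum1 n).
rewrite (bigD1_seq i) ?mem_index_iota ?iota_uniq //=; last by lia.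
rewrite lerDl big_seq_cond sumr_ge0 // => j.
by rewrite mem_index_iota => /andP[/andP[j0 _] _]; exact/ltW/pold_w_gt0.
Qed.

Hypothesis f01 : forall i t, 0 <= f t (xs i t) <= 1.

(** [w n] holds the weights of round [n + 1], hence the predecessor. *)
Local Notation mean t := (\sum_(1 <= i < N.+1) w t.-1 i * f t (xs i t)).

(** Averaging the quadratic bound on the exponential, with losses at most 1, gives
    [1 - alpha * mean + alpha ^ 2]; then [1 + x <= exp x]. *)
Lemma pold_Z_le n :
  \sum_(1 <= i < N.+1) w n i * expR (- alpha * f n.+1 (xs i n.+1))
  <= expR (- alpha * mean n.+1 + alpha ^+ 2).
Proof.
apply: le_trans (expR_ge1Dx _).
apply: (@le_trans _ _ (\sum_(1 <= i < N.+1)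
  (w n i + (- alpha * (w n i * f n.+1 (xs i n.+1)) + alpha ^+ 2 * w n i)))).
  rewrite big_nat_cond [leRHS]big_nat_cond; apply: ler_sum => i.
  case/andP=> /andP[i0 _] _; have /andP[f0 f1] := f01 i n.+1.
  have wi := pold_w_gt0 n i0.
  rewrite (_ : _ + _ = w n i * (1 + (- alpha * f n.+1 (xs i n.+1) + alpha ^+ 2))); last by ring.
  rewrite ler_pM2l // mulNr.
  apply: le_trans (expRN_le_quad (mulr_ge0 (ltW alpha0) f0)) _.
  rewrite -addrA !lerD2l exprMn ler_piMr ?exprn_ge0 ?(ltW alpha0) //.
  by rewrite exprn_ile1.
by rewrite 2!big_split /= -!mulr_sumr pold_w_sum1 mulr1.
Qed.

(** Each update multiplies the weight by the exponential of its loss and divides by a normaliser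
    that [pold_Z_le] bounds; the inequality unrolls this over [n] rounds. *)
Lemma pold_w_potential n i : (0 < i)%N ->
  w 0 i * expR (- alpha * \sum_(1 <= t < n.+1) f t (xs i t))
  <= w n i * expR (- alpha * \sum_(1 <= t < n.+1) mean t + n%:R * alpha ^+ 2).
Proof.
move=> i0; elim: n => [|n IH]; first by rewrite !big_geq // mulr0 mul0r addr0.
rewrite !(big_nat_recr n.+1) //=.
set F := \sum_(1 <= t < n.+1) f t _ in IH *.
set M := \sum_(1 <= t < n.+1) _ in IH *.
set Z := \sum_(1 <= mu < N.+1) w n mu * expR _.
set m := \sum_(1 <= i < N.+1) _.
have Z0 : 0 < Z by exact: pold_Z_gt0.
have Zle : Z <= expR (- alpha * m + alpha ^+ 2) := pold_Z_le n.
set e := expR (- alpha * f n.+1 (xs i n.+1)).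
have -> : - alpha * (F + f n.+1 (xs i n.+1)) = - alpha * F - alpha * f n.+1 (xs i n.+1).
  by ring.
rewrite -mulNr expRD mulrA -/e.
have -> : - alpha * (M + m) + n.+1%:R * alpha ^+ 2 =
  (- alpha * M + n%:R * alpha ^+ 2) + (- alpha * m + alpha ^+ 2).
  by rewrite -natr1; ring.
rewrite expRD.
apply: (@le_trans _ _ (w n i * expR (- alpha * M + n%:R * alpha ^+ 2) * e)).
  by rewrite ler_pM2r ?expR_gt0.
set E := expR (_ + n%:R * _); set E' := expR (_ + alpha ^+ 2) in Zle *.
have -> : w n i * e / Z * (E * E') = w n i * E * e * (E' / Z) by ring.
rewrite ler_peMr ?mulr_ge0 ?expR_ge0 ?(ltW (pold_w_gt0 _ _)) //.
by rewrite ler_pdivlMr // mul1r.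
Qed.

(** Logarithm of the potential inequality, with final weight at most 1 and initial weight at least
    [1 / (i (i + 1))]. The non-uniform prior makes the cost depend on [i] rather than on [N]. *)
Lemma hedge_regret T i : (0 < i <= N)%N ->
  \sum_(1 <= t < T.+1) mean t - \sum_(1 <= t < T.+1) f t (xs i t)
  <= ln ((i * i.+1)%:R : R) / alpha + T%:R * alpha.
Proof.
move=> iN; have /andP[i0 _] := iN.
set M := \sum_(1 <= t < T.+1) _; set F := \sum_(1 <= t < T.+1) _.
have ii : 0 < (i * i.+1)%:R :> R by rewrite ltr0n muln_gt0 i0.
have w0i : (i * i.+1)%:R^-1 <= w 0 i.
  rewrite /= natrM -natr1 -[leLHS]mul1r ler_wpM2r ?invr_ge0 ?mulr_ge0 ?addr_ge0 //.
  by rewrite lerDl invr_ge0.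
have h : (i * i.+1)%:R^-1 * expR (- alpha * F) <= expR (- alpha * M + T%:R * alpha ^+ 2).
  apply: (@le_trans _ _ (w 0 i * expR (- alpha * F))).
    by rewrite ler_pM2r ?expR_gt0.
  apply: le_trans (pold_w_potential T i0) _.
  by rewrite ler_piMl ?expR_ge0 // pold_w_le1.
have {h} : - ln ((i * i.+1)%:R : R) - alpha * F <= - alpha * M + T%:R * alpha ^+ 2.
  rewrite -ler_expR; apply: le_trans _ h.
  by rewrite -lnV ?posrE // -mulNr expRD lnK // posrE invr_gt0.
have -> : ln ((i * i.+1)%:R : R) / alpha + T%:R * alpha
    = (ln ((i * i.+1)%:R : R) + T%:R * alpha ^+ 2) / alpha.
  by field; rewrite gt_eqF.
rewrite ler_pdivlMr //; lra.
Qed.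


(** Jensen's inequality from the subgradient at the played point [x]: the weighted mean of
    [xs i t - x] vanishes, so the linear terms cancel. *)
Lemma pold_play_le_mean (K : set 'rV[R]_d) (G : R) (gt : 'rV[R]_d -> 'rV[R]_d) t :
  (0 < t)%N -> Defs.convex_set K -> loss_ok K G (f t) gt -> (forall i, K (xs i t)) ->
  f t (pold_play N alpha f xs t) <= mean t.
Proof.
move=> t0 cK [_ _ fc _] xK; rewrite /pold_play subn1.
set x := \sum_(_ <= i < _) _ *: _.
have Kx : K x.
  have := @convex_set_sum _ _ _ N _ _ cK (pold_w_gt0 t.-1) xK N0.
  by rewrite pold_w_sum1 invr1 scale1r.
have -> : f t x = \sum_(1 <= i < N.+1) w t.-1 i * (f t x + dotp (gt x) (xs i t - x)).
  under eq_bigr do rewrite mulrDr -dotpZr scalerBr.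
  rewrite big_split /= -mulr_suml pold_w_sum1 mul1r -dotp_sumr sumrB -scaler_suml.
  by rewrite pold_w_sum1 scale1r subrr dotpC dotp0l addr0.
rewrite big_nat_cond [leRHS]big_nat_cond; apply: ler_sum => i.
by case/andP=> /andP[i0 _] _; rewrite ler_pM2l ?pold_w_gt0 // fc.
Qed.

End Hedge.

(** * Roots, block sizes and the geometric grid of step sizes *)

Section Tuning.
Variable R : realType.
Implicit Types (a h : R).

(** This and the next two lemmas turn fractional powers into natural powers of a root, so that later
    estimates are polynomial. *)
Lemma powR_div_nat (n m : nat) a : 0 <= a -> a `^ (n%:R / m%:R) = (a `^ (1 / m%:R)) ^+ n.
Proof.
by move=> a0; rewrite -powR_mulrn ?powR_ge0 // -powRrM; congr (_ `^ _); ring.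
Qed.

Lemma powR_root (n : nat) a : (0 < n)%N -> 0 <= a -> (a `^ (1 / n%:R)) ^+ n = a.
Proof.
move=> n0 a0; rewrite -powR_div_nat // divff ?powRr1 //.
by rewrite pnatr_eq0 -lt0n.
Qed.

Lemma root_powR (n : nat) a : (0 < n)%N -> 0 <= a -> (a ^+ n) `^ (1 / n%:R) = a.
Proof.
move=> n0 a0; rewrite -powR_mulrn // -powRrM mul1r divff ?powRr1 //.
by rewrite pnatr_eq0 -lt0n.
Qed.

Lemma blocksize_gt0 (eta : R) : 0 < eta -> (0 < blocksize eta)%N.
Proof. by move=> eta0; rewrite absz_gt0 gt_eqF // ceil_gt0 powR_gt0. Qed.

(** With the step size written as [h ^+ 3], its power [-2/3] is [h ^- 2], and the ceiling adds at
    most 1. *)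
Lemma blocksize_le h : 0 < h -> (blocksize (h ^+ 3))%:R <= h ^- 2 + 1.
Proof.
move=> h0; rewrite /blocksize.
have -> : (h ^+ 3) `^ (- (2 / 3)) = h ^- 2.
  by rewrite powRN powR_div_nat ?exprn_ge0 ?ltW // root_powR // ltW.
set z := h ^- 2; have z0 : 0 < z by rewrite invr_gt0 exprn_gt0.
rewrite natr_absz ger0_norm; last by rewrite ceil_ge0; lra.
by have := ceilB1_lt z; rewrite rmorphB /=; lra.
Qed.

(** Doubling a step size multiplies its cube root by [2^(1/3)], the ratio [r] used here. The witness
    is the integer part of [ln q / ln r]. *)
Lemma grid_scale (q : R) : 1 <= q -> exists k : nat,
  (2 `^ (1 / 3 : R)) ^+ k <= q < (2 `^ (1 / 3 : R)) ^+ k.+1.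
Proof.
move=> q1; set r := 2 `^ _; have r0 : 0 < r by rewrite powR_gt0.
have l2 : 0 < ln (2 : R) by rewrite ln_gt0 // ltr1n.
have lr : 0 < ln r by rewrite ln_powR mulr_gt0.
have q0 : 0 < q by lra.
have /Num.Theory.truncn_itv : 0 <= ln q / ln r by rewrite divr_ge0 ?(ltW lr) ?ln_ge0.
set k := Num.truncn _; rewrite ler_pdivlMr // ltr_pdivrMr // => kq; exists k.
by rewrite -ler_ln ?posrE ?exprn_gt0 // -ltr_ln ?posrE ?exprn_gt0 // !lnXn //
   -[_ *+ k]mulr_natl -[_ *+ k.+1]mulr_natl.
Qed.

(** Taking logarithms, [k] is at most [3/4] of the binary logarithm of [1 + 4 T / 7], the number
    rounded up in [pold_N], whose final successor makes the inequality strict. *)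
Lemma grid_index (k T : nat) (q : R) : 0 < q ->
  (2 `^ (1 / 3 : R)) ^+ k <= q -> q ^+ 4 <= 1 + 4 * T%:R / 7 -> (k < pold_N R T)%N.
Proof.
move=> q0; set r := 2 `^ _; have r0 : 0 < r by rewrite powR_gt0.
have l2 : 0 < ln (2 : R) by rewrite ln_gt0 // ltr1n.
set B := 1 + _; have B1 : 1 <= B by rewrite lerDl divr_ge0 ?mulr_ge0.
rewrite -ler_ln ?posrE ?exprn_gt0 // lnXn // -[_ *+ k]mulr_natl ln_powR => kq.
rewrite -ler_ln ?posrE ?exprn_gt0 //; last by lra.
rewrite lnXn // -[_ *+ 4]mulr_natl => qB.
rewrite /pold_N ltnS -(ler_nat R) natr_absz ger0_norm; last first.
  by rewrite ceil_ge0 (@lt_le_trans _ _ 0) // mulr_ge0 ?divr_ge0 ?(ltW l2) ?ln_ge0.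
apply: le_trans (Num.Theory.ceil_ge _).
rewrite mulrA ler_pdivlMr //; lra.
Qed.

Lemma pold_etaE (Rad G : R) (T k : nat) :
  pold_eta Rad G T k.+1 =
  ((2 `^ (1 / 3)) ^+ k * ((7 * (2 * Rad) ^+ 2) / (2 * G ^+ 2)) `^ (1 / 4)
    / T%:R `^ (1 / 4)) ^+ 3.
Proof.
set X := 7 * (2 * Rad) ^+ 2 / (2 * G ^+ 2).
have X0 : 0 <= X by apply: divr_ge0; apply: mulr_ge0; rewrite ?sqr_ge0.
rewrite /pold_eta subn1 /= invfM mulrA -/X powR_div_nat; last first.
  by rewrite mulr_ge0 ?invr_ge0.
rewrite powRM ?invr_ge0 //.
have -> : (T%:R^-1 : R) `^ (1 / 4) = (T%:R `^ (1 / 4))^-1.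
  by rewrite -powR_inv1 // -powRrM mulN1r powRN.
by rewrite -mulrA [RHS]exprMn exprAC powR_root.
Qed.

(** [ln (n + 1) <= n] bounds the left side by [2 k + 1], and Bernoulli's inequality gives
    [r ^ k >= 1 + k / 4]. The logarithmic price of the expert's index is thus absorbed by the grid
    ratio. *)
Lemma log_index_le (k : nat) (r : R) : 5 / 4 <= r ->
  ln ((k.+1 * k.+2)%:R : R) <= 8 * r ^+ k.
Proof.
move=> r54; rewrite natrM lnM ?posrE //.
have l (n : nat) : ln (n.+1%:R : R) <= n%:R.
  by rewrite -natr1 addrC le_ln1Dx // (@lt_le_trans _ _ 0).
have rk : 1 + k%:R / 4 <= r ^+ k.
  elim: k => [|k IH]; first by rewrite mul0r addr0.
  rewrite exprS -natr1.
  have := ler_wpM2r (le_trans (addr_ge0 ler01 (divr_ge0 (ler0n R k) (ler0n R 4))) IH) r54.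
  by have := ler0n R k; lra.
have := l k; have := l k.+1; rewrite -[k.+1%:R]natr1; lra.
Qed.

End Tuning.

(** * The two regret bounds at the tuned parameters *)

Section TunedBounds.
Variable R : realType.

(** Since [c >= 1], [c] is at most its own power; this avoids roots of constants. *)
Lemma ler_root_scale (n : nat) (a b c : R) : 0 <= a -> 0 <= b -> 1 <= c ->
  a ^+ n.+1 <= c * b ^+ n.+1 -> a <= c * b.
Proof.
move=> a0 b0 c1 ab; have c0 : 0 <= c by lra.
rewrite -(ler_pXn2r (n := n.+1)) ?nnegrE ?mulr_ge0 // exprMn.
by apply: le_trans ab _; rewrite ler_wpM2r ?exprn_ge0 // ler_eXnr.
Qed.

(** Here [tau] stands for [T^(1/4)], [sigma] for [(1 + P)^(1/4)] and [h] for the cube root of the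
    step size. The hypotheses with [b] and [c] make [h] comparable to [sigma / tau], and
    [sigma <= L * tau] converts surplus factors of [sigma], so every monomial is
    [O(tau^3 sigma)]. *)
Lemma bogd_tuned_bound (D G P b c L tau sigma h Kb : R) :
  0 <= D -> 0 <= G -> 0 <= b -> 0 <= c -> 1 <= tau -> 1 <= sigma -> 0 < h ->
  h * tau <= b * sigma -> h^-1 * sigma <= c * tau -> sigma <= L * tau ->
  1 + P = sigma ^+ 4 -> Kb <= h ^- 2 + 1 ->
  tau ^+ 4 * (G * Num.sqrt (3 * h ^+ 2) + h ^+ 3 * Kb * G ^+ 2 / 2)
    + (D ^+ 2 + 2 * D * (P + D)) / (2 * h ^+ 3)
    + Kb * (G * (P + D) + 1)
  <= (2 * G * b + G ^+ 2 / 2 * (b + b ^+ 3 * L ^+ 2)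
      + (3 * D ^+ 2 + 2 * D) * c ^+ 3 / 2
      + (G * (1 + D) + 1) * (c ^+ 2 * L + L ^+ 3)) * (tau ^+ 3 * sigma).
Proof.
move=> D0 G0 b0 c0 tau1 sigma1 h0 hb hc sL Ps KbP.
have tau0 : 0 < tau by lra.
have sigma0 : 0 < sigma by lra.
have L0 : 0 <= L by rewrite -(pmulr_lge0 _ tau0); lra.
have v0 : 0 < h^-1 by rewrite invr_gt0.
have t3 : 0 <= tau ^+ 3 by rewrite exprn_ge0 // ltW.
have mono (n : nat) (x y : R) : 0 <= x -> x <= y -> x ^+ n <= y ^+ n.
  by move=> x0 xy; rewrite lerXn2r ?nnegrE // (le_trans x0).
have s1 (n : nat) : 1 <= sigma ^+ n by rewrite exprn_ege1.
have P0 : 0 <= P by have := s1 4%N; lra.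
have ht0 : 0 <= h * tau by rewrite mulr_ge0 ?ltW.
have vs0 : 0 <= h^-1 * sigma by rewrite mulr_ge0 ?ltW.
have sqrt3 : Num.sqrt (3 * h ^+ 2) <= 2 * h.
  rewrite (_ : 2 * h = Num.sqrt ((2 * h) ^+ 2)); last first.
    by rewrite sqrtr_sqr ger0_norm // mulr_ge0 // ltW.
  apply: ler_wsqrtr; rewrite exprMn.
  by rewrite ler_wpM2r ?sqr_ge0 //; lra.
have p1 : tau ^+ 4 * h <= b * (tau ^+ 3 * sigma).
  by have := ler_wpM2l t3 hb; lra.
(* [p2] and [p5] serve the [+ 1] left by rounding the block size. *)
have p2 : tau ^+ 4 * h ^+ 3 <= b ^+ 3 * L ^+ 2 * (tau ^+ 3 * sigma).
  have e1 := ler_wpM2l (ltW tau0) (mono 3%N _ _ ht0 hb).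
  have e2 : sigma ^+ 2 <= (L * tau) ^+ 2 by apply: mono => //; exact: ltW.
  have e3 := ler_wpM2l (mulr_ge0 (exprn_ge0 3 b0) (mulr_ge0 (ltW tau0) (ltW sigma0))) e2.
  by lra.
have p3 : sigma ^+ 4 * h^-1 ^+ 3 <= c ^+ 3 * (tau ^+ 3 * sigma).
  by have := ler_wpM2l (ltW sigma0) (mono 3%N _ _ vs0 hc); lra.
have p4 : sigma ^+ 4 * h^-1 ^+ 2 <= c ^+ 2 * L * (tau ^+ 3 * sigma).
  have e1 := ler_wpM2l (exprn_ge0 2 (ltW sigma0)) (mono 2%N _ _ vs0 hc).
  have e2 := ler_wpM2l (mulr_ge0 (exprn_ge0 2 c0)
     (mulr_ge0 (exprn_ge0 2 (ltW tau0)) (ltW sigma0))) sL.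
  by lra.
have p5 : sigma ^+ 4 <= L ^+ 3 * (tau ^+ 3 * sigma).
  have e1 : sigma ^+ 3 <= (L * tau) ^+ 3 by apply: mono => //; exact: ltW.
  by have := ler_wpM2l (ltW sigma0) e1; lra.
set p := tau ^+ 3 * sigma in p1 p2 p3 p4 p5 *.
(* [T1] to [T4] treat in turn the feasibility gap, the squared gradients, the telescoped distance
   with its drift, and the block length. *)
have T1 : tau ^+ 4 * (G * Num.sqrt (3 * h ^+ 2)) <= 2 * G * b * p.
  have e1 : G * Num.sqrt (3 * h ^+ 2) <= G * (2 * h) by rewrite ler_wpM2l.
  have := ler_wpM2l (exprn_ge0 4 (ltW tau0)) e1.
  by have := ler_wpM2l (mulr_ge0 (ler0n _ 2) G0) p1; lra.
have T2 : tau ^+ 4 * (h ^+ 3 * Kb * G ^+ 2 / 2) <= G ^+ 2 / 2 * (b + b ^+ 3 * L ^+ 2) * p.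
  have e1 : h ^+ 3 * Kb <= h + h ^+ 3.
    have -> : h + h ^+ 3 = h ^+ 3 * (h ^- 2 + 1) by field; rewrite gt_eqF.
    by rewrite ler_wpM2l // exprn_ge0 // ltW.
  have g2 : 0 <= G ^+ 2 / 2 by rewrite divr_ge0 ?sqr_ge0.
  have := ler_wpM2l (mulr_ge0 g2 (exprn_ge0 4 (ltW tau0))) e1.
  have := ler_wpM2l g2 (lerD p1 p2); lra.
have T3 : (D ^+ 2 + 2 * D * (P + D)) / (2 * h ^+ 3) <= (3 * D ^+ 2 + 2 * D) * c ^+ 3 / 2 * p.
  have D2 : 0 <= D ^+ 2 by rewrite sqr_ge0.
  have e1 : D ^+ 2 + 2 * D * (P + D) <= (3 * D ^+ 2 + 2 * D) * sigma ^+ 4.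
    by rewrite -Ps; have := ler_wpM2l D2 P0; lra.
  have v3 : 0 <= h^-1 ^+ 3 / 2 by rewrite divr_ge0 // exprn_ge0 // ltW.
  have -> : (D ^+ 2 + 2 * D * (P + D)) / (2 * h ^+ 3)
      = (D ^+ 2 + 2 * D * (P + D)) * (h^-1 ^+ 3 / 2) by field; rewrite gt_eqF.
  have := ler_wpM2r v3 e1.
  have E0 : 0 <= (3 * D ^+ 2 + 2 * D) / 2 by lra.
  by have := ler_wpM2l E0 p3; lra.
have T4 : Kb * (G * (P + D) + 1) <= (G * (1 + D) + 1) * (c ^+ 2 * L + L ^+ 3) * p.
  have GD : 0 <= G * D by rewrite mulr_ge0.
  have GP : 0 <= G * P by rewrite mulr_ge0.
  have Y0 : 0 <= G * (P + D) + 1 by lra.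
  have e1 : G * (P + D) + 1 <= (G * (1 + D) + 1) * sigma ^+ 4.
    by have := ler_wpM2l GD (s1 4%N); have := s1 4%N; rewrite -Ps; lra.
  have e2 := ler_wpM2r Y0 KbP.
  have w0 : 0 <= h ^- 2 + 1 by rewrite addr_ge0 // invr_ge0 exprn_ge0 // ltW.
  have e3 := ler_wpM2l w0 e1.
  have F0 : 0 <= G * (1 + D) + 1 by lra.
  have e4 := ler_wpM2l F0 (lerD p4 p5).
  apply: le_trans e2 _; apply: le_trans e3 _; apply: le_trans _ (le_trans e4 _).
    by rewrite exprVn; lra.
  by lra.
by lra.
Qed.

(** The learning rate is [sqrt 8 / tau^2] with [sqrt 8] between 2 and 3, so both terms are
    [O(tau^2 sigma)], and [tau >= 1] supplies the missing factor. *)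
Lemma hedge_tuned_bound (tau sigma l b : R) (T : nat) : 1 <= tau -> 1 <= sigma ->
  0 <= b -> tau ^+ 4 = T%:R -> l <= 8 * b * sigma ->
  l / pold_alpha R T + T%:R * pold_alpha R T <= (4 * b + 3) * (tau ^+ 3 * sigma).
Proof.
move=> tau1 sigma1 b0 tauT lb; have tau0 : 0 < tau by lra.
have e0 : 0 <= Num.sqrt (8 : R) by exact: sqrtr_ge0.
have e8 : Num.sqrt (8 : R) ^+ 2 = 8 by rewrite sqr_sqrtr.
have -> : pold_alpha R T = Num.sqrt 8 / tau ^+ 2.
  rewrite /pold_alpha -tauT sqrtrM // sqrtrV ?exprn_ge0 ?(ltW tau0) //.
  have -> : tau ^+ 4 = (tau ^+ 2) ^+ 2 by rewrite -exprM.
  by rewrite sqrtr_sqr ger0_norm // sqr_ge0.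
move: (Num.sqrt 8) e0 e8 => e e0 e8.
have e2 : 2 <= e by rewrite leNgt; apply/negP => h; nra.
have e3 : e <= 3 by rewrite leNgt; apply/negP => h; nra.
have t2 : 0 < tau ^+ 2 by rewrite exprn_gt0.
have -> : l / (e / tau ^+ 2) = l * (tau ^+ 2 / e) by field; rewrite !gt_eqF //; lra.
have -> : T%:R * (e / tau ^+ 2) = e * tau ^+ 2 by rewrite -tauT; field; rewrite gt_eqF.
have q1 : tau ^+ 2 / e <= tau ^+ 2 / 2 by rewrite ler_pM2l // lef_pV2 ?posrE //; lra.
have q0 : 0 <= tau ^+ 2 / e by rewrite divr_ge0 // ltW.
have a1 := ler_wpM2r q0 lb.
have bs : 0 <= 8 * b * sigma by rewrite !mulr_ge0 //; lra.
have a2 := ler_wpM2l bs q1.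
have a3 := ler_wpM2r (ltW t2) e3.
have s23 : tau ^+ 2 * sigma <= tau ^+ 3 * sigma.
  by rewrite ler_wpM2r ?exprS ?ler_peMl ?(ltW t2) //; lra.
have a4 := ler_wpM2l b0 s23.
have a5 := ler_wpM2l (ltW t2) sigma1.
by lra.
Qed.

End TunedBounds.

(** * Choice of the comparison expert and assembly of the bound *)

Unset Implicit Arguments.

Theorem theorem2 (R : realType) (Rad G : R) :
  0 < Rad -> 0 < G ->
  exists C : R, forall (d T : nat) (K : set 'rV[R]_d)
    (f : nat -> 'rV[R]_d -> R) (g : nat -> 'rV[R]_d -> 'rV[R]_d)
    (O : R -> 'rV[R]_d -> 'rV[R]_d -> 'rV[R]_d * 'rV[R]_d)
    (x1 : nat -> 'rV[R]_d) (u : nat -> 'rV[R]_d),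
    (1 <= T)%N ->
    A1 K Rad ->
    (forall t, loss_ok K G (f t) (g t)) ->
    IP_oracle K Rad O ->
    (forall i, K (x1 i)) ->
    (forall t, K (u t)) ->
    let N := pold_N R T in
    let xs := fun i t => expert_play O (pold_eta Rad G T i) (x1 i) g t in
    let x := pold_play N (pold_alpha R T) f xs in
    \sum_(1 <= t < T.+1) f t (x t) - \sum_(1 <= t < T.+1) f t (u t)
      <= C * (T%:R `^ (3 / 4) * (1 + path_length u T) `^ (1 / 4)).
Proof.
move=> Rad0 G0; set D := 2 * Rad; have D0 : 0 < D by rewrite mulr_gt0.
set c := (7 * D ^+ 2 / (2 * G ^+ 2)) `^ (1 / 4).
have c0 : 0 < c.
  by rewrite powR_gt0 // divr_gt0 // mulr_gt0 // exprn_gt0.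
set B := 1 + 4 / (7 * D); set A := 1 + 7 * D / 4; set L := 1 + D.
have B1 : 1 <= B by rewrite lerDl divr_ge0 // mulr_ge0 // ltW.
have A1' : 1 <= A by rewrite lerDl divr_ge0 // mulr_ge0 // ltW.
(* The first summand is the constant of [hedge_tuned_bound] at [b := B]; the rest is that of
   [bogd_tuned_bound] at [b := B * c] and [c := 2 * A / c]. *)
exists ((4 * B + 3) + (2 * G * (B * c) + G ^+ 2 / 2 * (B * c + (B * c) ^+ 3 * L ^+ 2)
      + (3 * D ^+ 2 + 2 * D) * (2 * A / c) ^+ 3 / 2
      + (G * (1 + D) + 1) * ((2 * A / c) ^+ 2 * L + L ^+ 3))).
move=> d T K f g O x1 u T0 [cK _ _ KR] fP OP x1K uK; cbv zeta.
set N := pold_N R T.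
set xs := fun i t => expert_play O (pold_eta Rad G T i) (x1 i) g t.
set x := pold_play N (pold_alpha R T) f xs.
set P := path_length u T; have P0 : 0 <= P by exact: path_length_ge0.
have uD s t : enorm (u s - u t) <= D.
  apply: le_trans (enormD _ _) _; rewrite enormN /D.
  by have := KR _ (uK s); have := KR _ (uK t); lra.
have PT : P <= T%:R * D by apply: path_length_le => //; exact: ltW.
have T1 : 1 <= T%:R :> R by rewrite ler1n.
set tau := (T%:R : R) `^ (1 / 4); set sigma := (1 + P) `^ (1 / 4).
have tau4 : tau ^+ 4 = T%:R by rewrite powR_root.
have sigma4 : 1 + P = sigma ^+ 4 by rewrite powR_root // addr_ge0.
have root_ge1 (a : R) : 1 <= a -> 1 <= a `^ (1 / 4).
  by move=> a1; rewrite -[X in X <= _](powRr0 a) ler_powR.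
have tau1 : 1 <= tau by exact: root_ge1.
have sigma1 : 1 <= sigma by apply: root_ge1; lra.
rewrite powR_div_nat // -/tau.
(* [q] is the cube root of the ratio of the target step size [((7 D^2 + 4 D P) / (2 G^2 T))^(3/4)]
   to the smallest one in the grid. *)
set q := (1 + 4 * P / (7 * D)) `^ (1 / 4).
have q4 : q ^+ 4 = 1 + 4 * P / (7 * D).
  by rewrite powR_root // addr_ge0 // divr_ge0 ?mulr_ge0 // ltW.
have q1 : 1 <= q.
  by apply: root_ge1; rewrite lerDl divr_ge0 ?mulr_ge0 // ltW.
have [k /andP[kq qk]] := grid_scale q1.
(* [P <= T * D] turns [q ^+ 4] into at most [1 + 4 T / 7], so the grid reaches far enough. *)
have kN : (k < N)%N.
  apply: grid_index kq _; first by lra.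
  rewrite q4 lerD2l -mulrA -[leRHS]mulrA ler_wpM2l // ler_pdivrMr ?mulr_gt0 //.
  by lra.
set r := 2 `^ _ in kq qk; have r0 : 0 < r by rewrite powR_gt0.
have r3 : r ^+ 3 = 2 by rewrite powR_root.
have r2 : r <= 2 by rewrite leNgt; apply/negP => h; nra.
(* [(5/4)^3 = 125/64 < 2]. *)
have r54 : 5 / 4 <= r by rewrite leNgt; apply/negP => h; nra.
have rk0 : 0 < r ^+ k by rewrite exprn_gt0.
(* [q ^+ 4] and [1 + P] are both affine in [P]; [B] and [A] are chosen to compare them in the two
   directions. *)
have qs : q <= B * sigma.
  apply: (@ler_root_scale _ 3) => //; [lra|lra|rewrite q4 -sigma4].
  rewrite -subr_ge0 (_ : _ - _ = P + 4 / (7 * D)); last by rewrite /B; field; rewrite gt_eqF.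
  by rewrite addr_ge0 // divr_ge0 // mulr_ge0 // ltW.
have sq : sigma <= A * q.
  apply: (@ler_root_scale _ 3) => //; [lra|lra|rewrite q4 -sigma4].
  rewrite -subr_ge0 (_ : _ - _ = 4 * P / (7 * D) + 7 * D / 4); last by rewrite /A; field; rewrite gt_eqF.
  by rewrite addr_ge0 // divr_ge0 // mulr_ge0 // ltW.
have sL : sigma <= L * tau.
  apply: (@ler_root_scale _ 3); rewrite -?sigma4 ?tau4 /L; [lra|lra|lra|].
  by rewrite mulrDl mul1r lerD // mulrC.
set h := r ^+ k * c / tau; have h0 : 0 < h by rewrite divr_gt0 ?mulr_gt0 //; lra.
have etaE : pold_eta Rad G T k.+1 = h ^+ 3 by rewrite pold_etaE.
(* This includes [i = 0], where the truncated [i - 1] gives the step size of index 1; feasibility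
   below can then be stated for every natural [i]. *)
have eta_gt0 i : 0 < pold_eta Rad G T i.
  rewrite mulr_gt0 ?exprn_gt0 // powR_gt0 // divr_gt0 // ?mulr_gt0 ?exprn_gt0 //.
  by rewrite ltr0n.
have xsK i t : K (xs i t).
  by apply: (@bogd_playK _ _ K Rad) => //; rewrite powR_gt0.
have f01 i t : 0 <= f t (xs i t) <= 1 by have [_ _ _] := fP t; apply.
have alpha0 : 0 < pold_alpha R T by rewrite sqrtr_gt0 divr_gt0 // ltr0n.
have N0 : (0 < N)%N by [].
pose mean t := \sum_(1 <= i < N.+1) pold_w N (pold_alpha R T) f xs t.-1 i * f t (xs i t).
have play_mean : \sum_(1 <= t < T.+1) f t (x t) <= \sum_(1 <= t < T.+1) mean t.
  rewrite big_nat_cond [leRHS]big_nat_cond; apply: ler_sum => t.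
  case/andP=> /andP[t0 _] _.
  exact: (pold_play_le_mean (pold_alpha R T) N0 t0 cK (fP t) (xsK^~ t)).
have hedge := hedge_regret N0 alpha0 f01 T (i := k.+1) kN.
(* [r ^+ k <= q] bounds [h] from above here; in [h2], [q < r ^+ k.+1] bounds it from below, the
   factor 2 there covering [r]. *)
have h1 : h * tau <= B * c * sigma.
  rewrite /h divfK; last by rewrite gt_eqF //; lra.
  have := ler_wpM2r (ltW c0) (le_trans kq qs); lra.
have h2 : h^-1 * sigma <= 2 * A / c * tau.
  rewrite mulrC ler_pdivrMr //.
  have -> : 2 * A / c * tau * h = A * (2 * r ^+ k).
    by rewrite /h; field; rewrite !gt_eqF //; lra.
  apply: le_trans sq _; rewrite ler_wpM2l //; first by lra.
  by apply: le_trans (ltW qk) _; rewrite exprS ler_wpM2r // ltW.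
have logk : ln ((k.+1 * k.+2)%:R : R) <= 8 * B * sigma.
  by apply: le_trans (log_index_le k r54) _; have := le_trans kq qs; lra.
have hedge_le := hedge_tuned_bound tau1 sigma1 (le_trans ler01 B1) tau4 logk.
have h3 : 0 < h ^+ 3 by rewrite exprn_gt0.
have epsE : (h ^+ 3) `^ (2 / 3) = h ^+ 2.
  by rewrite powR_div_nat ?ltW // root_powR // ltW.
have := bogd_regret KR fP OP (x1K k.+1) uK h3 (exprn_gt0 2 h0)
  (blocksize_gt0 h3) G0 T.
rewrite -/D -/P -tau4 => expert.
have expert_le := bogd_tuned_bound (ltW D0) (ltW G0) (mulr_ge0 (le_trans ler01 B1) (ltW c0))
  (divr_ge0 (mulr_ge0 (ler0n _ 2) (le_trans ler01 A1')) (ltW c0))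
  tau1 sigma1 h0 h1 h2 sL sigma4 (blocksize_le h0).
have xsE t : xs k.+1 t = bogd_play O (h ^+ 3) (blocksize (h ^+ 3)) (h ^+ 2) (x1 k.+1) g t.
  by rewrite /xs /expert_play etaE epsE.
rewrite (eq_bigr (fun t => f t (xs k.+1 t) - f t (u t))) in expert; last first.
  by move=> t _; rewrite xsE.
rewrite sumrB in expert; rewrite mulrDl.
move: hedge play_mean hedge_le expert expert_le; rewrite -/(mean _).
by lra.
Qed.
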